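(* Let $G$ be a $3$-connected simple graph with an odd number of vertices. If $G$ has at least two vertices of even degree, then $\chi'_o(G)\le 3$.
   Context: All graphs are finite and simple. For a graph $G$, a subgraph $H$ is an odd subgraph if every vertex of $H$ has odd degree in $H$. $G$ is odd $k$-edge-colorable if there is a map $c:E(G)\to\{1,\dots,k\}$ such that for each $i$ with $c^{-1}(i)\neq\emptyset$, the subgraph formed by the edge set $c^{-1}(i)$ (together with the endpoints of those edges) is an odd subgraph of $G$. The odd chromatic index $\chi'_o(G)$ is the minimum $k$ such that $G$ is odd $k$-edge-colorable. *)

(* Defs.v *)
From HB Require Import structures.
From mathcomp Require Import all_boot.

Set Implicit Arguments.
Unset Strict Implicit.
Unset Printing Implicit Defensive.

Record sgraph := SGraph {
  vertex :> finType;
  adj : rel vertex;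
  adj_sym : symmetric adj;
  adj_irrefl : irreflexive adj }.

Definition edges (G : sgraph) : {set {set G}} :=
  [set [set p.1; p.2] | p : G * G & adj p.1 p.2].

Definition edge (G : sgraph) := {A : {set G} | A \in edges G}.

Definition degree (T : finType) (F : {set {set T}}) (v : T) : nat :=
  #|[set A in F | v \in A]|.

Definition connected_on (G : sgraph) (W : {set G}) : Prop :=
  W != set0 /\
  {in W &, forall x y,
     connect [rel u v | [&& u \in W, v \in W & adj u v]] x y}.

(* ~: X is the vertex set of G - X. *)
Definition kconnected (k : nat) (G : sgraph) : Prop :=
  k < #|G| /\ forall X : {set G}, #|X| < k -> connected_on (~: X).

Definition subgraph (G : sgraph) (W : {set G}) (F : {set {set G}}) : bool :=
  (F \subset edges G) && [forall A in F, A \subset W].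

Definition odd_subgraph (G : sgraph) (W : {set G}) (F : {set {set G}}) : bool :=
  subgraph W F && [forall v in W, odd (degree F v)].

Definition color_class (G : sgraph) (k : nat) (c : {ffun edge G -> 'I_k})
    (i : 'I_k) : {set {set G}} :=
  [set val a | a : edge G & c a == i].

(* cover F is the set of endpoints of the edges in F. *)
Definition odd_edge_coloring (G : sgraph) (k : nat)
    (c : {ffun edge G -> 'I_k}) : bool :=
  [forall i, (color_class c i != set0) ==>
     odd_subgraph (cover (color_class c i)) (color_class c i)].

Definition odd_edge_colorable (G : sgraph) (k : nat) : bool :=
  [exists c : {ffun edge G -> 'I_k}, odd_edge_coloring c].

(* A single edge is an odd subgraph, so giving all edges distinct colors shows
   that the minimum defining the odd chromatic index exists. *)
Lemma ex_odd_edge_colorable (G : sgraph) : exists k, odd_edge_colorable G k.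
Proof.
exists #|{: edge G}|; apply/existsP; exists [ffun a => enum_rank a].
apply/forallP => i; apply/implyP => _.
have -> : color_class [ffun a : edge G => enum_rank a] i
          = [set val (enum_val i)].
  apply/setP => A; rewrite in_set1; apply/imsetP/eqP => [[a]|->].
    by rewrite inE ffunE => /eqP <- ->; rewrite enum_rankK.
  by exists (enum_val i); rewrite // inE ffunE enum_valK.
rewrite /cover big_set1; apply/andP; split.
  rewrite /subgraph sub1set (valP (enum_val i)).
  by apply/forall_inP => A /set1P ->.
apply/forall_inP => v vA; rewrite /degree.
suff -> : [set A in [set val (enum_val i)] | v \in A]
          = [set val (enum_val i)] by rewrite cards1.
apply/setP => A; rewrite !inE andb_idr // => /eqP ->.
exact: vA.
Qed.

Definition odd_chromatic_index (G : sgraph) : nat :=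
  ex_minn (ex_odd_edge_colorable G).

(* Main.v *)
Require Import Defs.
From mathcomp Require Import all_boot.

(* Let T be the set of even-degree vertices; |T| is odd.  Fix v in T and let N
   be its neighborhood, so |N| and |T - v| are even and nonzero.  Since G - v is
   2-connected, its vertex set splits into two connected parts A and B, each
   containing an odd number of vertices of T and of N.  All edges at v get color
   1 or 2; inside A and inside B one adds, as in a T-join, further edges of
   colors 1 and 2 so that the vertices of T have odd degree and all others even
   degree in their union, each of the two colors having odd degree or degree 0.
   Then the remaining edges, of color 3, have odd degree everywhere except at v,
   where they have degree 0.  Since A (resp. B) receives an odd number of edges
   from v, swapping the colors 1 and 2 on A flips the parity of the number of
   edges of color 1 at v coming from A, so both colors can be made odd at v. *)

Set Implicit Arguments.
Unset Strict Implicit.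
Unset Printing Implicit Defensive.

(** * Connectivity and bonds *)

Section Connectivity.

Variables (T : finType) (e : rel T).
Implicit Types (A B K R S U W Z : {set T}) (x y b t : T).

Definition closed_in S U := [forall x in S, forall y in U, e x y ==> (y \in S)].

(* Connectivity by cuts; the empty set is connected in this sense. *)
Definition conn U :=
  [forall S : {set T}, [&& S \subset U, S != set0 & closed_in S U] ==> (U \subset S)].

Lemma closed_inP S U :
  reflect (forall x y, x \in S -> y \in U -> e x y -> y \in S) (closed_in S U).
Proof.
apply: (iffP forall_inP) => [h x y xS yU exy | h x xS].
  by move/forall_inP: (h x xS) => /(_ y yU) /implyP; apply.
by apply/forall_inP => y yU; apply/implyP; exact: h.
Qed.

Lemma connP U :
  reflect (forall S x, S \subset U -> x \in S -> closed_in S U -> U \subset S)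
          (conn U).
Proof.
apply: (iffP forallP) => [h S x SU xS Sc | h S].
  by apply: (implyP (h S)); rewrite SU Sc andbT; apply/set0Pn; exists x.
by apply/implyP => /and3P[SU /set0Pn[x xS] Sc]; exact: h xS Sc.
Qed.

(** The intersection of [S] and [K] is nonempty and closed in [S], hence all of [S]. *)
Lemma conn_sub_closed S K Z x :
  conn S -> S \subset Z -> closed_in K Z -> x \in S -> x \in K -> S \subset K.
Proof.
move=> /connP Sconn SZ /closed_inP Kc xS xK.
suff /subset_trans : S \subset S :&: K by apply; exact: subsetIr.
apply: (Sconn _ x); rewrite ?subsetIl ?inE ?xS //.
apply/closed_inP => y z; rewrite !inE => /andP[yS yK] zS eyz.
by rewrite zS (Kc y) // (subsetP SZ).
Qed.

Lemma conn1 x : conn [set x].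
Proof. by apply/connP => S y; rewrite subset1 => /orP[/eqP->|/eqP->]; rewrite ?inE. Qed.

Hypothesis e_sym : symmetric e.

Lemma closed_inC S U : S \subset U -> closed_in S U -> closed_in (U :\: S) U.
Proof.
move=> SU /closed_inP Sc; apply/closed_inP => x y; rewrite !inE => /andP[xS xU] yU exy.
by rewrite yU andbT; apply: contra xS => yS; apply: Sc yS xU _; rewrite e_sym.
Qed.

Lemma connU A B x y :
  conn A -> conn B -> x \in A -> y \in B -> e x y -> conn (A :|: B).
Proof.
move=> Aconn Bconn xA yB exy; apply/connP => S z SU zS Sc.
have sub C u : conn C -> C \subset A :|: B -> u \in C -> u \in S -> C \subset S.
  by move=> Cc CU; exact: conn_sub_closed Cc CU Sc.
have subA u := sub A u Aconn (subsetUl A B).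
have subB u := sub B u Bconn (subsetUr A B).
move/closed_inP: Sc => Sc.
rewrite subUset; case/setUP: (subsetP SU _ zS) => [zA | zB].
  have AS := subA z zA zS; rewrite AS (subB y) //.
  by apply: Sc exy; rewrite ?(subsetP AS) // inE yB orbT.
have BS := subB z zB zS; rewrite BS (subA x) //.
by apply: (Sc y); rewrite ?(subsetP BS) 1?e_sym // inE xA.
Qed.

(** A closed part of [U :\: K] that misses [R] has no edge to [K], since [K] is closed in [U :\: R].
    It is then closed in [U], so it is empty, as [U] is connected and contains [r]. Hence a nonempty
    closed part contains [R], and its complement in [U :\: K], again closed, is empty. *)
Lemma connD U R K r :
  conn U -> conn R -> r \in R -> R \subset U -> K \subset U :\: R ->
  closed_in K (U :\: R) -> conn (U :\: K).
Proof.
move=> /connP Uconn Rconn rR RU KUR /closed_inP Kc.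
have RK : R \subset U :\: K.
  apply/subsetP => x xR; rewrite inE (subsetP RU) // andbT.
  by apply/negP => /(subsetP KUR); rewrite inE xR.
have grow S : S \subset U :\: K -> [disjoint S & R] -> closed_in S (U :\: K) -> S = set0.
  move=> SUK dSR /closed_inP Sc.
  have SU : S \subset U by apply: subset_trans SUK (subsetDl _ _).
  case: (set_0Vmem S) => // -[x xS].
  suff /subsetP/(_ r (subsetP RU _ rR)) rS : U \subset S.
    by move/disjointFr: dSR => /(_ r rS); rewrite rR.
  apply: (Uconn _ x) => //; apply/closed_inP => y z yS zU eyz.
  apply: (Sc y z) => //; rewrite inE zU andbT; apply/negP => zK.
  have := subsetP SUK y yS; rewrite inE => /andP[/negP[]].
  apply: (Kc z); rewrite 1?e_sym // inE (subsetP SU) // andbT.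
  by rewrite (disjointFr dSR).
apply/connP => S x SUK xS Sc.
case: (boolP [disjoint S & R]) => [/(grow S SUK)/(_ Sc) S0 | ].
  by rewrite S0 inE in xS.
rewrite -setI_eq0 => /set0Pn[y]; rewrite inE => /andP[yS yR].
have RS := conn_sub_closed Rconn RK Sc yR yS.
rewrite -setD_eq0; apply/eqP/grow; rewrite ?subsetDl ?closed_inC //.
by rewrite disjoints_subset setDE; apply/subsetP => z;
  rewrite !inE => /andP[_]; apply: contra; exact: subsetP RS z.
Qed.

(** A maximal connected subset of [Z] through [t] is closed in [Z], since a neighbor could be
    adjoined. *)
Lemma component_exists Z t :
  t \in Z -> exists K, [/\ K \subset Z, t \in K, conn K & closed_in K Z].
Proof.
move=> tZ; pose p K := [&& K \subset Z, t \in K & conn K].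
have [|K /maxsetP[/and3P[KZ tK Kconn] Kmax]] := @ex_maxset _ p.
  by exists [set t]; rewrite /p sub1set tZ set11 conn1.
exists K; split=> //; apply/closed_inP => x y xK yZ exy.
have <- : K :|: [set y] = K; last by rewrite !inE eqxx orbT.
apply: Kmax; last exact: subsetUl.
by rewrite /p subUset KZ sub1set yZ inE tK (connU Kconn (conn1 y) xK (set11 y)).
Qed.

(** Builds [A] up from the empty set. A nonempty proper part of [A] is not closed in [A], so some
    edge leaves it and gives the next vertex. *)
Lemma conn_ind (Q : {set T} -> Prop) A :
  conn A -> Q set0 ->
  (forall S y, S \subset A -> y \in A -> y \notin S ->
     S = set0 \/ (exists2 x, x \in S & e x y) -> Q S -> Q (y |: S)) ->
  Q A.
Proof.
move=> /connP Aconn Q0 QU.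
suff [S [SA QS /eqP cS]] : exists S, [/\ S \subset A, Q S & #|S| == #|A|].
  by have /eqP <- : S == A by rewrite eqEcard SA cS /=.
suff: forall n, n <= #|A| -> exists S, [/\ S \subset A, Q S & #|S| == n] by exact.
elim=> [_|n IHn ltn]; first by exists set0; rewrite sub0set cards0.
have [S [SA QS /eqP cS]] := IHn (ltnW ltn).
have [y yA [yS ex]] : exists2 y, y \in A & y \notin S /\
    (S = set0 \/ exists2 x, x \in S & e x y).
  have AS : ~~ (A \subset S).
    by apply/negP => /subset_leq_card; rewrite leqNgt cS ltn.
  case: (set_0Vmem S) => [S0 | [x xS]].
    have [y yA yS] := subsetPn AS; exists y => //; split=> //; by left.
  have: ~~ closed_in S A by apply: contra AS; exact: Aconn xS.
  case/forall_inPn => z zS /forall_inPn[y yA]; rewrite negb_imply => /andP[ezy yS].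
  by exists y => //; split=> //; right; exists z.
exists (y |: S); split; rewrite ?cardsU1 ?yS ?cS //.
  by rewrite subUset sub1set yA.
exact: QU.
Qed.

(** * Bonds and the vertices attached to one of their sides *)

Lemma setD_compl U K : K \subset U -> U :\: (U :\: K) = K.
Proof. by move=> /setIidPr KU; rewrite setDDr setDv set0U. Qed.

(** Names a bond by one side: when both sides are nonempty and [U] is connected, the edges between
    them form a minimal cut of [U]. *)
Definition bond U A := [&& A \subset U, conn A & conn (U :\: A)].

Definition component Z t K := [&& K \subset Z, t \in K, conn K & closed_in K Z].

Lemma closed_inW S U Z : U \subset Z -> closed_in S Z -> closed_in S U.
Proof.
move=> UZ /closed_inP Sc; apply/closed_inP => x y xS yU; apply: Sc xS _.
exact: subsetP UZ y yU.
Qed.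

(** The set [A :|: [set b]] is connected and [K] is closed in the rest, so [connD] applies. The new
    side contains [A] and [b] and avoids [t]. *)
Lemma component_bond U A t a b K :
  conn U -> bond U A -> a \in A -> b \in U :\: A -> e a b ->
  component ((U :\: A) :\ b) t K -> bond U (U :\: K).
Proof.
move=> Uconn /and3P[AU Aconn Bconn] aA bB eab /and4P[KB tK Kconn Kc].
have KU : K \subset U.
  by apply: subset_trans KB _; apply: subset_trans (subsetDl _ _) (subsetDl _ _).
have bU : b \in U by move: bB; rewrite inE => /andP[].
have UR : U :\: (A :|: [set b]) = (U :\: A) :\ b by rewrite setDDl.
rewrite /bond subsetDl (setD_compl KU) Kconn andbT /=.
apply: (@connD U (A :|: [set b]) K a); rewrite ?UR //.
- exact: (connU Aconn (conn1 b) aA (set11 b)).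
- by rewrite inE aA.
- by rewrite subUset AU sub1set.
Qed.

(* If b and b' are attached to A and neither separates the other from t, then
   A can absorb the part that {b, b'} cuts off from t, or only what of that part
   is not already cut off by b' alone. *)
Lemma two_attachments U A t a a' b b' K K' :
  conn U -> bond U A ->
  a \in A -> e a b -> a' \in A -> e a' b' ->
  b \in U :\: A -> b' \in U :\: A -> b != t -> b' != t ->
  component ((U :\: A) :\ b) t K -> b' \in K ->
  component ((U :\: A) :\ b') t K' -> b \in K' ->
  exists K'', [/\ K'' \subset K', t \in K'', b \notin K'',
     bond U (U :\: K'') & bond U (A :|: (K' :\: K''))].
Proof.
move=> Uconn bondA aA eab a'A eab' bB b'B bt b't.
set B := U :\: A.
move=> compK b'K compK' bK'.
have /and3P[AU Aconn Bconn] := bondA.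
have /and4P[KB tK Kconn Kc] := compK.
have /and4P[K'B tK' K'conn K'c] := compK'.
have tB : t \in B by have := subsetP KB t tK; rewrite in_setD1 => /andP[].
(* [K''] is the component of [t] once both [b] and [b'] are deleted; it lies in [K] and in [K']. *)
have [K'' [K''B tK'' K''conn K''c]] : exists K'', [/\ K'' \subset B :\ b :\ b', t \in K'',
    conn K'' & closed_in K'' (B :\ b :\ b')].
  by apply: component_exists; rewrite !in_setD1 tB eq_sym b't eq_sym bt.
have K''Bb : K'' \subset B :\ b := subset_trans K''B (subsetDl _ _).
have K''Bb' : K'' \subset B :\ b'.
  by apply: subset_trans K''B _; rewrite setDDl setUC -setDDl subsetDl.
have K''K : K'' \subset K := conn_sub_closed K''conn K''Bb Kc tK'' tK.
have K''K' : K'' \subset K' := conn_sub_closed K''conn K''Bb' K'c tK'' tK'.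
have bK'' : b \notin K''.
  by apply/negP => /(subsetP K''B); rewrite !in_setD1 eqxx andbF.
have b'K'' : b' \notin K''.
  by apply/negP => /(subsetP K''B); rewrite !in_setD1 eqxx.
have KsubB : K \subset B := subset_trans KB (subsetDl _ _).
have K'subB : K' \subset B := subset_trans K'B (subsetDl _ _).
have BU : B \subset U := subsetDl _ _.
have bU := subsetP BU b bB; have b'U := subsetP BU b' b'B.
have notA x : x \in B -> x \notin A by rewrite inE => /andP[].
exists K''; split=> //.
  have K''U : K'' \subset U := subset_trans (subset_trans K''K KsubB) BU.
  rewrite /bond subsetDl (setD_compl K''U) K''conn andbT /=.
  have UR : U :\: (A :|: [set b] :|: [set b']) = B :\ b :\ b' by rewrite !setDDl setUA.
  apply: (@connD U (A :|: [set b] :|: [set b']) K'' a); rewrite ?UR //.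
  - apply: connU (conn1 b') _ (set11 b') eab'; last by rewrite inE a'A.
    exact: (connU Aconn (conn1 b) aA (set11 b) eab).
  - by rewrite !inE aA.
  - by rewrite !subUset AU !sub1set bU.
rewrite /bond subUset AU (subset_trans (subset_trans (subsetDl _ _) K'subB)) //=.
apply/andP; split.
  have -> : A :|: (K' :\: K'') = (A :|: K') :\: K''.
    rewrite setDUl; congr (_ :|: _); symmetry; apply/setDidPl.
    rewrite disjoint_sym disjoints_subset; apply/subsetP => x /(subsetP K''K) /(subsetP KsubB).
    by move/notA; rewrite inE.
  have UR : (A :|: K') :\: (A :|: [set b]) \subset B :\ b :\ b'.
    apply/subsetP => x; rewrite in_setD !in_setU in_set1 negb_or => /andP[/andP[/negPf-> xb] /= xK'].
    have := subsetP K'B x xK'; rewrite !in_setD1 => /andP[-> ->].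
    by rewrite xb.
  (* Inside [A :|: K'], the set [K''] is closed outside the connected set [A :|: [set b]]. *)
  apply: (@connD (A :|: K') (A :|: [set b]) K'' a).
  - exact: (connU Aconn K'conn aA bK' eab).
  - exact: (connU Aconn (conn1 b) aA (set11 b) eab).
  - by rewrite inE aA.
  - by rewrite setUS // sub1set.
  - apply/subsetP => x xK''; rewrite in_setD !in_setU in_set1 (subsetP K''K') // orbT andbT negb_or.
    rewrite notA ?(subsetP KsubB) ?(subsetP K''K) //=.
    by apply: contraNneq bK'' => <-.
  - exact: closed_inW UR K''c.
have -> : U :\: (A :|: (K' :\: K'')) = (B :\: K') :|: K''.
  apply/setP => x; rewrite !inE negb_or negb_and negbK.
  case xK'' : (x \in K''); last by rewrite !orbF /= andbCA andbA.
  have xB := subsetP KsubB x (subsetP K''K x xK'').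
  by rewrite orbT notA //= (subsetP BU).
have Dconn : conn (B :\: K').
  by apply: (@connD B [set b'] K' b'); rewrite ?conn1 ?set11 ?sub1set.
(* [K] is connected and contains [t] and [b'], so an edge leaves [K''] inside [K]. It can only end
   at [b'], which lies in [B :\: K']; this joins the two pieces. *)
have : ~~ closed_in K'' K.
  apply: contra b'K'' => /(conn_sub_closed Kconn (subxx K)) KK''.
  by apply: (subsetP (KK'' t tK tK'')).
case/forall_inPn => x xK'' /forall_inPn[y yK]; rewrite negb_imply => /andP[exy yK''].
have yb' : y = b'.
  apply/eqP; apply: contraNT yK'' => yb'.
  move/closed_inP: K''c => /(_ x y xK''); apply=> //.
  by rewrite in_setD1 yb' (subsetP KB).
rewrite setUC; apply: (connU K''conn Dconn xK'' _ exy).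
rewrite yb' inE b'B andbT; apply/negP => /(subsetP K'B).
by rewrite in_setD1 eqxx.
Qed.

(** * Bond sides that are odd for two vertex sets *)

Lemma odd_cardIU W A B : [disjoint A & B] ->
  odd #|(A :|: B) :&: W| = odd #|A :&: W| (+) odd #|B :&: W|.
Proof.
move=> dAB; rewrite setIUl cardsU setIACA (disjoint_setI0 dAB) set0I cards0 subn0.
exact: oddD.
Qed.

Lemma bond1 U x : x \in U -> conn (U :\ x) -> bond U [set x].
Proof. by move=> xU Uconn; rewrite /bond sub1set xU conn1. Qed.

Lemma odd_cardI1 W x : odd #|[set x] :&: W| = (x \in W).
Proof.
case: (boolP (x \in W)) => xW; first by rewrite (setIidPl _) ?sub1set ?cards1.
by rewrite disjoint_setI0 ?cards0 // disjoints1.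
Qed.

Lemma neighbor_outside U A a x :
  conn U -> A \subset U -> a \in A -> x \in U -> x \notin A ->
  exists a' b, [/\ a' \in A, b \in U :\: A & e a' b].
Proof.
move=> /connP Uconn AU aA xU xA.
have: ~~ closed_in A U by apply: contra xA => Ac; exact: (subsetP (Uconn _ _ AU aA Ac)).
case/forall_inPn => a' a'A /forall_inPn[b bU]; rewrite negb_imply => /andP[eab bA].
by exists a', b; split; rewrite // inE bA.
Qed.

(* Take t in N and a maximal bond side A avoiding t with odd |A & W|.  If no bond
   side is odd for both W and N, every larger bond side avoiding t is even for W,
   and two vertices attached to A as in two_attachments give a contradiction. *)
Lemma odd_odd_bond U W (N : {set T}) :
  conn U -> {in U, forall x, conn (U :\ x)} ->
  W \subset U -> N \subset U -> W != set0 -> N != set0 ->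
  exists A, [/\ bond U A, odd #|A :&: W| & odd #|A :&: N|].
Proof.
move=> Uconn Uconn1 WU NU /set0Pn[s sW] /set0Pn[t tN].
pose q A := [&& bond U A, odd #|A :&: W| & odd #|A :&: N|].
case: (boolP [exists A, q A]) => [/existsP[A /and3P[]] | noq]; first by exists A.
have {noq} noq A : bond U A -> odd #|A :&: W| -> ~~ odd #|A :&: N|.
  move=> bA WA; apply/negP => NA.
  by case/existsP: noq; exists A; rewrite /q bA WA.
exfalso.
have sU := subsetP WU s sW; have tU := subsetP NU t tN.
(* Singletons are bond sides, so a common vertex of [W] and [N] would be a side odd for both. *)
have sN : s \notin N.
  by rewrite -odd_cardI1; apply: noq; rewrite ?odd_cardI1 // bond1 ?Uconn1.
have tW : t \notin W.
  rewrite -odd_cardI1; apply: contraL tN => /noq; rewrite odd_cardI1; apply.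
  by rewrite bond1 ?Uconn1.
pose p A := [&& bond U A, t \notin A & odd #|A :&: W|].
have [|A /maxsetP[/and3P[bondA tA WA] Amax]] := @ex_maxset _ p.
  exists [set s]; rewrite /p bond1 ?Uconn1 // odd_cardI1 sW andbT in_set1.
  by apply: contraNneq tW => ->.
have NA := noq _ bondA WA.
have even_above A' x : bond U A' -> A \subset A' -> t \notin A' ->
    x \in A' -> x \notin A -> ~~ odd #|A' :&: W|.
  move=> bA' AA' tA' xA'; apply: contra => WA'.
  by rewrite -(Amax A') // /p bA' tA'.
have /and3P[AU Aconn Bconn] := bondA.
have [a0 a0A] : exists a, a \in A.
  apply/set0Pn; apply: contraTneq WA => ->.
  by rewrite set0I cards0.
set B := U :\: A in Bconn.
have tB : t \in B by rewrite inE tA.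
have BU : B \subset U := subsetDl _ _.
have notA x : x \in B -> x \notin A by rewrite inE => /andP[].
(* By maximality of [A], the sides [U :\: K''], [U :\: K'] and [A :|: (K' :\: K'')] are all even for
   [W]. The first two make [K' :\: K''] even, while the third makes it odd because [A] is odd. *)
have two a a' b b' K K' :
    a \in A -> e a b -> a' \in A -> e a' b' -> b \in B -> b' \in B ->
    b != t -> b' != t -> component (B :\ b) t K -> b' \in K ->
    component (B :\ b') t K' -> b \in K' -> False.
  move=> aA eab a'A eab' bB b'B bt b't cK b'K cK' bK'.
  have [K'' [K''K' tK'' bK'' bond1 bond2]] :=
    two_attachments Uconn bondA aA eab a'A eab' bB b'B bt b't cK b'K cK' bK'.
  have bond3 := component_bond Uconn bondA a'A b'B eab' cK'.
  have /and4P[K'B tK' _ _] := cK'.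
  have K'subB : K' \subset B := subset_trans K'B (subsetDl _ _).
  have AK' (C : {set T}) : C \subset K' -> A \subset U :\: C.
    move=> CK'; apply/subsetP => x xA; rewrite inE (subsetP AU) // andbT.
    by apply/negP => /(subsetP CK')/(subsetP K'subB)/notA; rewrite xA.
  have W1 : ~~ odd #|(U :\: K'') :&: W|.
    apply: (even_above _ b) => //; rewrite ?AK' ?notA // inE ?tK'' //.
    by rewrite bK'' (subsetP BU).
  have W2 : ~~ odd #|(A :|: (K' :\: K'')) :&: W|.
    apply: (even_above _ b) => //; rewrite ?subsetUl ?notA // !inE ?tK'' //.
      by rewrite (negPf tA).
    by rewrite bK'' bK' orbT.
  have W3 : ~~ odd #|(U :\: K') :&: W|.
    apply: (even_above _ b') => //; rewrite ?AK' ?notA // inE ?tK' //.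
    rewrite (subsetP BU) // andbT; apply/negP => /(subsetP K'B).
    by rewrite in_setD1 eqxx.
  have defU : U :\: K'' = (U :\: K') :|: (K' :\: K'').
    apply/setP => x; rewrite !inE; case xK' : (x \in K') => /=.
      by rewrite (subsetP BU) ?(subsetP K'subB) // orbC.
    by rewrite andbF orbF; case xK'' : (x \in K''); rewrite // (subsetP K''K') in xK'.
  move: W1 W2; rewrite defU !odd_cardIU ?WA ?(negPf W3) /=.
  - by move/negPf=> ->.
  - rewrite disjoint_sym disjoints_subset; apply/subsetP => x; rewrite inE => /andP[_ xK'].
    by rewrite inE notA // (subsetP K'subB).
  - by rewrite disjoints_subset; apply/subsetP => x; rewrite !inE negb_and => /andP[-> _]; rewrite orbT.
have comp b : b != t -> exists K, component (B :\ b) t K.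
  move=> bt; have [|K [? ? ? ?]] := @component_exists (B :\ b) t.
    by rewrite in_setD1 eq_sym bt.
  by exists K; apply/and4P.
case: (boolP [exists a in A, e a t]) => [/exists_inP[a aA eat] | not_adj].
  (* If [B :\ t] is connected, [t] can move to the side of [A]. As [t] is in [N] but not in [W],
     that side becomes odd for both. *)
  case: (boolP (conn (B :\ t))) => [Btconn | ].
    have: bond U (A :|: [set t]).
      rewrite /bond subUset AU sub1set tU (connU Aconn (conn1 t) aA (set11 t) eat).
      by rewrite -setDDl.
    have dAt : [disjoint A & [set t]] by rewrite disjoint_sym disjoints1.
    move/noq; rewrite !odd_cardIU // !odd_cardI1 WA (negPf NA) (negPf tW) tN.
    by move=> /(_ isT).
  case/forallPn => S; rewrite negb_imply => /andP[/and3P[SB /set0Pn[x xS] Sc]].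
  case/subsetPn => y yB yS; set S' := (B :\ t) :\: S.
  have yS' : y \in S' by rewrite inE yS yB.
  have S'B : S' \subset B :\ t := subsetDl _ _.
  have S'c : closed_in S' (B :\ t) := closed_inC SB Sc.
  (* No edge joins [S] and [S'], so connectivity of [U :\ t] gives each of them an edge to [A]. *)
  have attach (C : {set T}) z : C \subset B :\ t -> z \in C -> closed_in C (B :\ t) ->
      exists a b, [/\ a \in A, b \in C & e a b].
    move=> CB zC Cc.
    have CU : C \subset U :\ t by apply: subset_trans CB (setSD _ BU).
    have [||c [b [cC bUC ecb]]] := neighbor_outside (Uconn1 t tU) CU zC (x := a0).
    - by rewrite in_setD1 (subsetP AU) // andbT; apply: contraNneq tA => <-.
    - by apply/negP => /(subsetP CB); rewrite in_setD1 => /andP[_ /notA]; rewrite a0A.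
    exists b, c; split; rewrite 1?e_sym //.
    move: bUC; rewrite in_setD in_setD1 => /and3P[bC bt bU].
    apply: contraNT bC => bA; move/closed_inP: Cc => /(_ c b cC); apply=> //.
    by rewrite in_setD1 bt inE bA.
  have [a1 [b [a1A bS eab]]] := attach S x SB xS Sc.
  have [a2 [b' [a2A b'S' eab']]] := attach S' y S'B yS' S'c.
  (* Deleting [c'] outside [C] does not cut [c] off from [t]: the part of [C] cut off would be
     closed in the connected set [B] and miss [t]. *)
  have sep (C : {set T}) c c' (K : {set T}) : C \subset B :\ t -> closed_in C (B :\ t) ->
      c \in C -> c' \notin C -> component (B :\ c') t K -> c \in K.
    move=> CB Cc cC c'C /and4P[KB tK Kconn Kc].
    apply/negPn/negP => cK.
    have CKB : C :\: K \subset B.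
      by apply: subset_trans (subsetDl _ _) (subset_trans CB (subsetDl _ _)).
    have CKc : closed_in (C :\: K) B.
      apply/closed_inP => z w /setDP[zC zK] wB ezw; rewrite inE.
      have zB : z \in B :\ c'.
        rewrite in_setD1 (subsetP CKB) ?inE ?zK ?zC // andbT.
        by apply: contraNneq c'C => <-.
      have wK : w \notin K.
        apply: contra zK => wK; move/closed_inP: Kc => /(_ w z wK zB); apply.
        by rewrite e_sym.
      rewrite wK /=; move/closed_inP: Cc => /(_ z w zC); apply=> //.
      by rewrite in_setD1 wB andbT; apply: contraNneq wK => ->.
    have cCK : c \in C :\: K by rewrite inE cK.
    move/connP: Bconn => /(_ _ c CKB cCK CKc)/subsetP/(_ t tB).
    by rewrite inE tK.
  have Bt (C : {set T}) c : C \subset B :\ t -> c \in C -> (c \in B) /\ c != t.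
    by move=> CB cC; have := subsetP CB c cC; rewrite in_setD1 => /andP[].
  have [bB bt] := Bt S b SB bS.
  have [b'B b't] := Bt S' b' S'B b'S'.
  have [K cK] := comp b bt; have [K' cK'] := comp b' b't.
  apply: (two a1 a2 b b' K K') => //.
    by apply: sep S'B S'c b'S' _ cK; rewrite inE bS.
  by apply: sep SB Sc bS _ cK'; move: b'S'; rewrite inE => /andP[].
have nt a b : a \in A -> e a b -> b != t.
  move=> aA eab; apply: contraNneq not_adj => <-.
  by apply/exists_inP; exists a.
(* When [t] has no neighbor in [A], [b] is chosen among the vertices attached to [A] so that the
   component [K] of [t] in [B :\ b] is minimal. *)
pose hanging K := [exists a in A, exists b in B, e a b && component (B :\ b) t K].
have [|K /minsetP[/exists_inP[a aA /exists_inP[b bB /andP[eab cK]]] Kmin]] := @ex_minset _ hanging.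
  have [a [b [aA bB eab]]] := neighbor_outside Uconn AU a0A tU tA.
  have [K cK] := comp b (nt a b aA eab); exists K.
  by apply/exists_inP; exists a => //; apply/exists_inP; exists b; rewrite ?eab.
have /and4P[KB tK Kconn Kc] := cK.
have KsubB : K \subset B := subset_trans KB (subsetDl _ _).
have bU := subsetP BU b bB.
(* [K] is closed in [B :\ b], so an edge leaving it in the connected set [U :\ b] ends in [A]. *)
have [||b' [a' [b'K a'U eb'a']]] := neighbor_outside (Uconn1 b bU) (subset_trans KB (setSD _ BU)) tK (x := a0).
- by rewrite in_setD1 (subsetP AU) // andbT; apply: contraTneq a0A => ->; exact: notA.
- by apply/negP => /(subsetP KsubB)/notA; rewrite a0A.
have a'A : a' \in A.
  move: a'U; rewrite in_setD in_setD1 => /and3P[a'K a'b a'U].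
  apply: contraNT a'K => a'A; move/closed_inP: Kc => /(_ b' a' b'K); apply=> //.
  by rewrite in_setD1 a'b inE a'A.
have b'B := subsetP KsubB b' b'K.
have ea'b' : e a' b' by rewrite e_sym.
have b't := nt a' b' a'A ea'b'.
have [K' cK'] := comp b' b't.
have /and4P[K'B tK' K'conn _] := cK'.
apply: (two a a' b b' K K') => //; first exact: nt aA eab.
(* Were [b] outside [K'], then [K'] would lie in [K] and equal it by minimality, although [b'] is in
   [K] only. *)
apply/negPn/negP => bK'.
have K'K : K' \subset K.
  apply: (conn_sub_closed K'conn _ Kc tK' tK).
  apply/subsetP => x xK'; rewrite in_setD1 (subsetP (subset_trans K'B (subsetDl _ _))) // andbT.
  by apply: contraNneq bK' => <-.
have K'eq : K' = K.
  apply: Kmin K'K; apply/exists_inP; exists a' => //.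
  by apply/exists_inP; exists b'; rewrite ?ea'b'.
by move: b'K; rewrite -K'eq => /(subsetP K'B); rewrite in_setD1 eqxx.
Qed.

End Connectivity.

(** * Two-colorings with prescribed degree parities *)

Definition odd_or_zero n := (n != 0) ==> odd n.

(** If [Q] is odd, all of it gets color [k]. If it is even and nonempty, [f0] alone gets [k], and an
    odd number of elements remains for the other color. *)
Lemma odd_or_zero_split (X : finType) (Q : {set X}) (f0 : X) (k : bool) :
  (Q != set0 -> f0 \in Q) ->
  exists h : X -> bool, h f0 = k /\ forall b, odd_or_zero #|[set f in Q | h f == b]|.
Proof.
move=> Qf0; exists (fun f => if f == f0 then k else k (+) ~~ odd #|Q|).
rewrite eqxx; split=> // b; case: (set_0Vmem Q) => [-> | [f fQ]].
  by rewrite (_ : [set _ in _ | _] = set0) ?cards0 //; apply/setP => f; rewrite !inE.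
have {}Qf0 : f0 \in Q by apply: Qf0; apply/set0Pn; exists f.
have cQ := cardsD1 f0 Q; rewrite Qf0 in cQ.
rewrite /odd_or_zero; case: (boolP (odd #|Q|)) => oQ.
  rewrite (_ : [set _ in _ | _] = if k == b then Q else set0).
    by case: (k == b); rewrite ?oQ ?implybT // cards0.
  apply/setP => g; rewrite inE addbF if_same.
  by case: (k == b); rewrite ?andbT ?andbF ?inE.
rewrite (_ : [set _ in _ | _] = if k == b then [set f0] else Q :\ f0).
  case: (k == b); rewrite ?cards1 //.
  by move: oQ; rewrite cQ /= negbK => ->; rewrite implybT.
apply/setP => g; rewrite inE addbT; case: (eqVneq g f0) => [-> | gf0].
  by rewrite Qf0 /=; case: (k == b); rewrite !inE eqxx.
by case: k b => [] []; rewrite !inE ?gf0 ?(negPf gf0) /= ?andbT ?andbF.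
Qed.

(** * Extending a two-coloring over a connected vertex set *)

Section Coloring.

Variable G : sgraph.
Implicit Types (A S : {set G}) (P J F : {set {set G}}) (f g : {set G}) (u v x y : G).

Lemma edge_in x y : adj x y -> [set x; y] \in edges G.
Proof. by move=> xy; apply/imsetP; exists (x, y); rewrite // inE. Qed.

Lemma edgeP f : reflect (exists x y, adj x y /\ f = [set x; y]) (f \in edges G).
Proof.
apply: (iffP imsetP) => [[[x y]] | [x [y [xy ->]]]]; last by exists (x, y); rewrite // inE.
by rewrite inE /= => xy ->; exists x, y.
Qed.

Lemma adj_neq x y : adj x y -> x != y.
Proof. by apply: contraTneq => ->; rewrite adj_irrefl. Qed.

Lemma card_edge f : f \in edges G -> #|f| = 2.
Proof. by case/edgeP => x [y [/adj_neq xy ->]]; rewrite cards2 xy. Qed.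

Definition incident F u := [set f in F | u \in f].

Lemma degreeE F u : degree F u = #|incident F u|.
Proof. by []. Qed.

Lemma card_meet_unique f A x y :
  #|f :&: A| = 1 -> x \in f -> x \in A -> y \in f -> y \in A -> x = y.
Proof.
by move/eqP/cards1P => [z fA] xf xA yf yA;
  have : x \in f :&: A by [rewrite inE xf]; have : y \in f :&: A by [rewrite inE yf];
  rewrite fA !inE => /eqP -> /eqP ->.
Qed.

(* P consists of pendant edges, with exactly one end in A; J lies inside A. *)
Definition extends_coloring A (tau : pred G) P J (c : {set G} -> bool) :=
  [/\ J \subset edges G, {in J, forall f, f \subset A},
      {in A, forall u, odd (degree (P :|: J) u) = tau u} &
      {in A, forall u b, odd_or_zero (degree [set f in P :|: J | c f == b] u)}].

(* The edge xy is added when the pendant edges at y have the wrong parity; for S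
   it is one more pendant edge, whose color then dictates the colors at y. *)
Lemma extend_coloring_step S y (tau : pred G) :
  y \notin S -> S = set0 \/ (exists2 x, x \in S & adj x y) ->
  (forall P, {in P, forall f, #|f :&: S| = 1} ->
     odd #|P| = odd #|[set u in S | tau u]| ->
     exists J c, extends_coloring S tau P J c) ->
  forall P, {in P, forall f, #|f :&: (y |: S)| = 1} ->
     odd #|P| = odd #|[set u in y |: S | tau u]| ->
     exists J c, extends_coloring (y |: S) tau P J c.
Proof.
move=> yS adjS IH P PA oddP.
pose Py := incident P y; pose need := odd #|Py| (+) tau y.
have oddtau : odd #|[set u in y |: S | tau u]| = tau y (+) odd #|[set u in S | tau u]|.
  rewrite (cardsD1 y) inE setU11 /= oddD oddb; congr (_ (+) odd #|pred_of_set _|).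
  by apply/setP => u; rewrite !inE; case: eqP => //= ->; rewrite (negPf yS).
have PyP : Py \subset P by apply/subsetP => f; rewrite inE => /andP[].
have yPy f : f \in Py -> y \in f by rewrite inE => /andP[].
have PyS f u : f \in Py -> u \in S -> u \notin f.
  move=> fPy uS; apply/negP => uf; have fP := subsetP PyP f fPy.
  have uy := card_meet_unique (PA f fP) uf (setU1r y uS) (yPy f fPy) (setU11 y S).
  by rewrite -uy uS in yS.
have PnS f : f \in P -> f \notin Py -> y \notin f by move=> fP; rewrite inE fP.
(* If [S] is empty, every edge of [P] meets [y], so the parity hypothesis makes [need] false and any
   [x] will do. *)
have [x xS] : exists x, need -> x \in S /\ adj x y.
  case: adjS => [S0 | [x xS xy]]; last by exists x.
  exists y; rewrite /need; suff -> : #|Py| = #|P|.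
    rewrite oddP oddtau S0 (_ : [set _ in _ | _] = set0) ?cards0 ?addbF ?addbb //.
    by apply/setP => u; rewrite !inE.
  congr #|pred_of_set _|; apply/eqP; rewrite eqEsubset PyP; apply/subsetP => f fP.
  rewrite inE fP; move: (PA f fP); rewrite S0 setU0 => /eqP/cards1P[z fy].
  by have : z \in f :&: [set y]; [rewrite fy set11 | rewrite !inE => /andP[zf /eqP <-]].
pose g := [set x; y]; pose E := if need then [set g] else set0.
have EP f : f \in E -> need /\ f = g.
  by rewrite /E; case: ifP; rewrite inE // => _ /eqP.
have cE : #|E| = need by rewrite /E; case: ifP => _; rewrite ?cards1 ?cards0.
have gS : need -> #|g :&: S| = 1.
  move=> nd; have [xS' xy] := xS nd; apply/eqP/cards1P; exists x; apply/setP => u.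
  rewrite !inE; case: (eqVneq u x) => [-> | _] //=.
  by case: eqP => // ->; rewrite (negPf yS).
have gA : need -> #|g :&: (y |: S)| = 2.
  move=> nd; have [xS' xy] := xS nd; rewrite (setIidPl _) ?card_edge ?edge_in //.
  by rewrite subUset !sub1set setU11 setU1r.
(* The edge [g] has both ends in [y |: S], while an edge of [P] has only one there. *)
have dPE : [disjoint P :\: Py & E].
  rewrite disjoint_sym disjoints_subset; apply/subsetP => f /EP[nd ->].
  by rewrite !inE; apply/negP => /andP[_ /PA]; rewrite gA.
have dPyE : [disjoint Py & E].
  rewrite disjoint_sym disjoints_subset; apply/subsetP => f /EP[nd ->].
  by rewrite inE; apply/negP => /(subsetP PyP)/PA; rewrite gA.
pose P' := (P :\: Py) :|: E.
have [||J [c [JE JS Jodd Jcol]]] := IH P'.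
- move=> f /setUP[/setDP[fP fPy] | /EP[nd ->]]; last exact: gS.
  rewrite -(PA f fP); congr #|pred_of_set _|; apply/setP => u; rewrite !inE.
  by case: eqP => // ->; rewrite (negPf (PnS f fP fPy)).
- rewrite cardsU (disjoint_setI0 dPE) cards0 subn0 oddD cE oddb cardsDS //.
  rewrite oddB ?subset_leq_card // oddP oddtau /need.
  by case: (tau y); case: (odd #|Py|); case: (odd _).
pose Q := Py :|: E.
have cQ : odd #|Q| = tau y.
  rewrite cardsU (disjoint_setI0 dPyE) cards0 subn0 oddD cE oddb /need.
  by rewrite addbA addbb.
(* The coloring of [S] has already fixed the color of [g]; without [g], any edge at [y] may serve,
   and the default matters only for empty [Q]. *)
pose f0 := if need then g else odflt g [pick f in Q].
have [|h [hf0 hodd]] := @odd_or_zero_split _ Q f0 (c g).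
  rewrite /f0 /Q /E; case: ifP => [_ _ | _]; first by rewrite in_setU set11 orbT.
  by case/set0Pn => f fQ; case: pickP => [f' //|/(_ f)]; rewrite fQ.
have hg : need -> h g = c g by move=> nd; rewrite -hf0 /f0 nd.
(* Only the edges at [y] are recolored. Among them only [g] can reach [S], and there [h] agrees with
   [c]. *)
pose c' f := if y \in f then h f else c f.
have yJ f : f \in J -> y \notin f.
  by move=> fJ; apply/negP => yf; rewrite (subsetP (JS f fJ) y yf) in yS.
have yg : y \in g by rewrite !inE eqxx orbT.
have incy : incident (P :|: (J :|: E)) y = Q.
  apply/setP => f; rewrite !inE; case: (boolP (f \in E)) => [/EP[_ ->] | fE].
    by rewrite yg !orbT.
  case: (boolP (f \in J)) => [/yJ/negPf-> | _]; rewrite ?orbF ?andbF //.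
have memE f u : u \in S -> (f \in P :|: (J :|: E)) && (u \in f) =
                          (f \in P' :|: J) && (u \in f).
  move=> uS; case: (boolP (u \in f)) => uf; rewrite ?andbF ?andbT //.
  have fPy : f \notin Py by apply/negP => /PyS/(_ uS); rewrite uf.
  by rewrite !in_setU in_setD fPy /= -!orbA; congr (_ || _); rewrite orbC.
exists (J :|: E), c'; split.
- rewrite subUset JE; apply/subsetP => f /EP[nd ->]; apply: edge_in.
  by have [] := xS nd.
- move=> f /setUP[/JS fS | /EP[nd ->]]; first exact: subset_trans fS (subsetUr _ _).
  by have [xS' _] := xS nd; rewrite subUset !sub1set setU11 setU1r.
- move=> u /setU1P[-> | uS]; first by rewrite degreeE incy cQ.
  rewrite -(Jodd u uS); congr (odd #|pred_of_set _|); apply/setP => f.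
  by rewrite [LHS]inE [RHS]inE memE.
move=> u /setU1P[-> | uS] b.
  have := hodd b; rewrite /odd_or_zero; suff -> : degree [set f in P :|: (J :|: E) | c' f == b] y =
    #|[set f in Q | h f == b]| by [].
  congr #|pred_of_set _|; apply/setP => f; rewrite -incy !inE /c'.
  by case: (y \in f); rewrite ?andbF ?andbT.
have := Jcol u uS b; rewrite /odd_or_zero.
suff -> : degree [set f in P :|: (J :|: E) | c' f == b] u = degree [set f in P' :|: J | c f == b] u by [].
congr #|pred_of_set _|; apply/setP => f; rewrite [LHS]inE [RHS]inE [in LHS]inE [in RHS]inE.
rewrite andbAC memE // [in RHS]andbAC.
case: (boolP (f \in P' :|: J)) => //= fF; congr (_ && _).
rewrite /c'; case: ifP => // yf; congr (_ == _).
case/setUP: fF => [/setUP[/setDP[fP fPy]|/EP[nd ->]]|/yJ]; rewrite ?yf ?hg //.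
by have := PnS f fP fPy; rewrite yf.
Qed.

(** Induction by [conn_ind]. The property must quantify over [P], because each step changes the
    pendant edges. *)
Lemma extend_coloring A (tau : pred G) P :
  conn (@adj G) A -> {in P, forall f, #|f :&: A| = 1} ->
  odd #|P| = odd #|[set u in A | tau u]| ->
  exists J c, extends_coloring A tau P J c.
Proof.
move=> Aconn; move: P; pose colorable S := forall P,
  {in P, forall f, #|f :&: S| = 1} -> odd #|P| = odd #|[set u in S | tau u]| ->
  exists J c, extends_coloring S tau P J c.
apply: (@conn_ind _ _ colorable A Aconn); last first.
  by move=> S y _ _ yS adjS IH P; exact: (extend_coloring_step yS adjS IH).
move=> P _ _; exists set0, (fun=> true).
by split; rewrite ?sub0set // => u; rewrite inE.
Qed.

(** As [P] is odd, exactly one color occurs an odd number of times on it. Exchanging the colors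
    throughout [P :|: J] decides which one. *)
Lemma extend_coloring_parity A (tau : pred G) P (p : bool) :
  conn (@adj G) A -> {in P, forall f, #|f :&: A| = 1} ->
  odd #|P| -> odd #|[set u in A | tau u]| ->
  exists J c, extends_coloring A tau P J c /\
     forall b, odd #|[set f in P | c f == b]| = (p == b).
Proof.
move=> Aconn PA oP otau.
have [|J [c [JE JA Jodd Jcol]]] := @extend_coloring A tau P Aconn PA; first by rewrite oP otau.
pose q := odd #|[set f in P | c f]|.
have cP b : odd #|[set f in P | c f == b]| = (q == b).
  have cID := cardsID [set f | c f] P.
  have cT : P :&: [set f | c f] = [set f in P | c f] by apply/setP => f; rewrite !inE.
  have cF : P :\: [set f | c f] = [set f in P | c f == false].
    by apply/setP => f; rewrite !inE eqbF_neg andbC.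
  case: b; last by move: oP; rewrite -cID cT cF oddD -/q; case: q; case: (odd _).
  by rewrite eqb_id; congr (odd #|pred_of_set _|); apply/setP => f; rewrite !inE eqb_id.
exists J, (fun f => c f (+) (p != q)).
have cE b f : (c f (+) (p != q) == b) = (c f == b (+) (p != q)).
  by case: (c f); case: (p != q); case: b.
split; first split=> //.
  move=> u uA b; rewrite (_ : [set _ in _ | _] = [set f in P :|: J | c f == b (+) (p != q)]).
    exact: Jcol.
  by apply/setP => f; rewrite !inE cE.
move=> b; rewrite (_ : [set _ in _ | _] = [set f in P | c f == b (+) (p != q)]).
  by rewrite cP; case: (p); case: (q); case: (b).
by apply/setP => f; rewrite !inE cE.
Qed.

End Coloring.

(** * Assembling the three colors *)

Lemma sum_degree (T : finType) (F : {set {set T}}) :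
  \sum_v degree F v = \sum_(f in F) #|f|.
Proof.
transitivity (\sum_v \sum_(f in F) (v \in f : nat)).
  apply: eq_bigr => v _; rewrite /degree -sum1_card big_mkcond /= [RHS]big_mkcond.
  by apply: eq_bigr => f _; rewrite inE; case: (f \in F); case: (v \in f).
rewrite exchange_big; apply: eq_bigr => f _.
by rewrite -sum1_card [RHS]big_mkcond; apply: eq_bigr => v _; case: (v \in f).
Qed.

Lemma odd_sum (T : finType) (d : T -> nat) :
  odd (\sum_v d v) = odd #|[set v | odd (d v)]|.
Proof.
rewrite -sum1_card [in RHS]big_mkcond !(big_morph odd oddD (erefl _)).
by apply: eq_bigr => v _; rewrite inE; case: (odd (d v)).
Qed.

(** The degree sum is twice the number of edges, so the vertices of odd degree are even in
    number. *)
Lemma odd_card_even_degree (G : sgraph) :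
  odd #|[set v : G | ~~ odd (degree (edges G) v)]| = odd #|G|.
Proof.
rewrite -(cardsC [set v : G | odd (degree (edges G) v)]) oddD -odd_sum sum_degree.
rewrite (eq_bigr (fun=> 2)); last by move=> f; exact: card_edge.
rewrite sum_nat_const oddM andbF addFb; congr (odd #|pred_of_set _|).
by apply/setP => v; rewrite !inE.
Qed.

Lemma connected_on_conn (G : sgraph) (W : {set G}) :
  connected_on W -> conn (@adj G) W.
Proof.
case=> _ Wconn; apply/connP => S x SW xS /closed_inP Sc; apply/subsetP => y yW.
have /connectP[p] := Wconn x y (subsetP SW x xS) yW.
elim: p x xS => [|z p IHp] x xS /=; first by move=> _ ->.
by case/andP => /and3P[xW zW xz]; apply: IHp; exact: Sc xS zW xz.
Qed.

(** The endpoints of a color class are its vertices of nonzero degree, so degree zero has to be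
    allowed elsewhere. Coloring arbitrary sets avoids membership proofs in [edge G]. *)
Lemma odd_chromatic_index_le (G : sgraph) k (col : {set G} -> 'I_k) :
  (forall i u, odd_or_zero (degree [set f in edges G | col f == i] u)) ->
  odd_chromatic_index G <= k.
Proof.
move=> colP; rewrite /odd_chromatic_index; case: ex_minnP => m _; apply.
apply/existsP; exists [ffun a => col (val a)]; apply/forallP => i.
have -> : color_class [ffun a : edge G => col (val a)] i = [set f in edges G | col f == i].
  apply/setP => f; rewrite inE; apply/imsetP/andP => [[a] | [fE cf]].
    by rewrite inE ffunE => ca ->; split => //; exact: valP.
  by exists (Sub f fE); rewrite ?inE ?ffunE SubK.
apply/implyP => _; apply/andP; split.
  apply/andP; split; first by apply/subsetP => f; rewrite inE => /andP[].
  by apply/forall_inP => f fF; exact: bigcup_sup.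
apply/forall_inP => u /bigcupP[f fF uf].
apply: (implyP (colP i u)); rewrite -lt0n; apply/card_gt0P; exists f.
by rewrite inE fF.
Qed.

(** * Half-colorings around a vertex and their union *)

Section Assembly.

Variables (G : sgraph) (v : G).
Implicit Types (A B C : {set G}) (F : {set {set G}}) (c : {set G} -> bool) (u : G).

Definition nbrs := [set x | adj v x].
Definition star A := [set [set v; x] | x in A :&: nbrs].

Lemma set2_inj_r x y : [set v; x] = [set v; y] -> x = y.
Proof.
move=> E; have : x \in [set v; y] by rewrite -E set22.
have : y \in [set v; x] by rewrite E set22.
by rewrite !inE => /orP[/eqP -> /orP[/eqP|/eqP] | /eqP].
Qed.

Lemma card_star A : #|star A| = #|A :&: nbrs|.
Proof. by rewrite card_imset // => x y; exact: set2_inj_r. Qed.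

Lemma star_edges A : star A \subset edges G.
Proof.
by apply/subsetP => f /imsetP[x /setIP[_]]; rewrite inE => vx ->; exact: edge_in.
Qed.

Lemma incident_star : incident (edges G) v = star setT.
Proof.
apply/setP => f; rewrite inE; apply/andP/imsetP => [[/edgeP[x [y [xy ->]]]] | [x]].
  rewrite !inE => /orP[/eqP vx | /eqP vy].
    by exists y; rewrite ?inE vx.
  by exists x; [rewrite !inE vy -(adj_sym x y) | rewrite vy setUC].
by rewrite !inE => vx ->; rewrite edge_in // set21.
Qed.

Lemma star_meet A f : v \notin A -> f \in star A -> #|f :&: A| = 1.
Proof.
move=> vA /imsetP[x /setIP[xA _] ->]; apply/eqP/cards1P; exists x.
apply/setP => u; rewrite !inE; case: (eqVneq u x) => [->|_]; first by rewrite xA orbT.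
by rewrite orbF; case: eqP => // ->; rewrite (negPf vA).
Qed.

(** [F] holds the edges of the first two colors on one side of the bond. Its degree parities are
    opposite to those of [G], so that the edges left over have odd degree on [A]. *)
Definition half_coloring A F c :=
  [/\ F \subset edges G, {in F, forall f : {set G}, f \subset v |: A},
      star A = incident F v,
      {in A, forall u, odd (degree F u) = ~~ odd (degree (edges G) u)} &
      {in A, forall u b, odd_or_zero (degree [set f in F | c f == b] u)}].

Lemma half_coloring_exists A (p : bool) :
  conn (@adj G) A -> v \notin A -> odd #|A :&: nbrs| ->
  odd #|[set u in A | ~~ odd (degree (edges G) u)]| ->
  exists F c, half_coloring A F c /\
    forall b, odd (degree [set f in F | c f == b] v) = (p == b).
Proof.
move=> Aconn vA oN oT.
have [|||J [c [[JE JA Jodd Jcol] cP]]] :=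
  @extend_coloring_parity G A (fun u => ~~ odd (degree (edges G) u)) (star A) p Aconn; rewrite ?card_star //.
  by move=> f; exact: star_meet.
have vJ f : f \in J -> v \notin f.
  by move=> /JA fA; apply: contra vA; exact: subsetP fA v.
have vstar f : f \in star A -> v \in f.
  by case/imsetP => x _ ->; rewrite set21.
exists (star A :|: J), c; split; first split=> //.
- by rewrite subUset star_edges.
- move=> f /setUP[/imsetP[x /setIP[xA _] ->] | /JA fA].
    by rewrite subUset !sub1set setU11 setU1r.
  exact: subset_trans fA (subsetUr _ _).
- apply/setP => f; rewrite inE in_setU; case: (boolP (f \in J)) => [/vJ fJ | _].
    by rewrite (negPf fJ) andbF; apply: contraNF fJ; exact: vstar.
  by rewrite orbF andb_idr //; exact: vstar.
move=> b; rewrite -cP; congr (odd #|pred_of_set _|); apply/setP => f.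
rewrite !inE; case: (boolP (f \in J)) => [/vJ fJ | _].
  by rewrite (negPf fJ) andbF; apply/esym; apply: contraNF fJ => /andP[/vstar].
by rewrite orbF; case: (boolP (f \in star A)) => //= /vstar ->; rewrite andbT.
Qed.

(** No edge of [F'] contains [u], so only [F] counts there, and an even degree loses an odd number
    of edges or an odd degree an even number. *)
Lemma half_coloring_local A B F F' c c' u :
  half_coloring A F c -> half_coloring B F' c' -> u \in A -> u \notin v |: B ->
  (forall b, odd_or_zero
     (degree ([set f in F | c f == b] :|: [set f in F' | c' f == b]) u)) /\
  odd (degree (edges G :\: (F :|: F')) u).
Proof.
move=> [FE FA _ Fodd Fcol] [F'E F'B _ _ _] uA uB.
have uF' f : f \in F' -> u \notin f.
  by move=> /F'B fB; apply: contra uB; exact: subsetP fB u.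
split=> [b|].
  have := Fcol u uA b; rewrite /odd_or_zero.
  suff -> : degree ([set f in F | c f == b] :|: [set f in F' | c' f == b]) u =
    degree [set f in F | c f == b] u by [].
  congr #|pred_of_set _|; apply/setP => f; rewrite !inE.
  by case: (boolP (f \in F')) => [/uF'/negPf-> | _]; rewrite ?andbF ?orbF.
have -> : degree (edges G :\: (F :|: F')) u = degree (edges G) u - degree F u.
  have sub : incident F u \subset incident (edges G) u.
    by apply/subsetP => f; rewrite !inE => /andP[/(subsetP FE)->].
  rewrite !degreeE -(cardsDS sub); congr #|pred_of_set _|; apply/setP => f.
  rewrite !inE; case: (boolP (f \in F')) => [/uF'/negPf-> | _]; rewrite ?andbF ?orbF //.
  by case: (u \in f); rewrite ?andbF ?andbT.
rewrite oddB ?Fodd //; first by case: (odd _).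
by apply/subset_leq_card/subsetP => f; rewrite !inE => /andP[/(subsetP FE)->].
Qed.

Lemma glue_half_colorings A B F F' c c' :
  A :|: B = ~: [set v] -> [disjoint A & B] ->
  half_coloring A F c -> half_coloring B F' c' ->
  (forall b, odd (degree [set f in F | c f == b] v) = (true == b)) ->
  (forall b, odd (degree [set f in F' | c' f == b] v) = (false == b)) ->
  odd_chromatic_index G <= 3.
Proof.
move=> AB dAB hF hF' oF oF'.
have [FE FA starA _ _] := hF; have [F'E F'B starB _ _] := hF'.
have nv u : (u \in A) || (u \in B) = (u != v).
  by rewrite -in_setU AB !inE.
have vA : v \notin A by have := nv v; rewrite eqxx; case: (v \in A).
have vB : v \notin B by have := nv v; rewrite eqxx orbC; case: (v \in B).
(* A common edge would lie in both [v |: A] and [v |: B], hence in [[set v]]. *)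
have dF f : f \in F -> f \notin F'.
  move=> fF; apply/negP => fF'; have := card_edge (subsetP FE f fF).
  suff /subset_leq_card : f \subset [set v] by rewrite cards1 => h c2; rewrite c2 in h.
  apply/subsetP => x xf; have := subsetP (FA f fF) x xf; have := subsetP (F'B f fF') x xf.
  rewrite !inE; case: eqP => //= _ xB xA.
  by rewrite (disjointFr dAB xA) in xB.
pose enc (b : bool) : 'I_3 := if b then ord0 else inord 1.
pose col f := if f \in F then enc (c f) else if f \in F' then enc (c' f) else ord_max.
have encE b b' : (enc b == enc b') = (b == b').
  by rewrite /enc -val_eqE; case: b; case: b'; rewrite /= ?inordK.
have enc2 b : (enc b == ord_max) = false.
  by rewrite /enc -val_eqE; case: b; rewrite /= ?inordK.
have colE b : [set f in edges G | col f == enc b] =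
    [set f in F | c f == b] :|: [set f in F' | c' f == b].
  apply/setP => f; rewrite !inE /col.
  case: (boolP (f \in F)) => [fF | fF] /=.
    by rewrite (subsetP FE) // encE (negPf (dF f fF)) orbF.
  case: (boolP (f \in F')) => fF' /=; first by rewrite (subsetP F'E) // encE.
  by rewrite eq_sym enc2 andbF.
have col2 : [set f in edges G | col f == ord_max] = edges G :\: (F :|: F').
  apply/setP => f; rewrite !inE /col andbC negb_or.
  by case: (f \in F); case: (f \in F'); rewrite /= ?enc2 ?eqxx.
apply: (@odd_chromatic_index_le G 3 col) => i u.
have /orP[/existsP[b /eqP ->] | /eqP ->] : [exists b, i == enc b] || (i == ord_max).
  case: i => [[|[|[|//]]] lti].
  - by apply/orP; left; apply/existsP; exists true; rewrite -val_eqE.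
  - by apply/orP; left; apply/existsP; exists false; rewrite -val_eqE /= inordK.
  - by apply/orP; right; rewrite -val_eqE.
- rewrite colE; case: (eqVneq u v) => [-> | uv].
    (* At [v] the degrees from the two halves add up, and each color is odd in exactly one half. *)
    apply/implyP => _; rewrite (_ : degree _ v = degree [set f in F | c f == b] v +
       degree [set f in F' | c' f == b] v) ?oddD ?oF ?oF'; first by case: (b).
    rewrite !degreeE (_ : incident _ v = incident [set f in F | c f == b] v :|:
       incident [set f in F' | c' f == b] v).
      rewrite cardsU disjoint_setI0 ?cards0 ?subn0 // disjoints_subset.
      apply/subsetP => f; rewrite !inE => /andP[/andP[/dF/negPf-> _] _].
      by [].
    by apply/setP => f; rewrite !inE andb_orl.
  move: uv; rewrite -nv => /orP[uA | uB].
    by have [] := half_coloring_local hF hF' uA; rewrite // in_setU1 negb_or -nv uA (disjointFr dAB uA).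
  rewrite setUC.
  by have [] := half_coloring_local hF' hF uB; rewrite // in_setU1 negb_or -nv uB orbT (disjointFl dAB uB).
(* The third color is absent at [v], because every edge at [v] belongs to [star A] or [star B]. *)
rewrite col2; case: (eqVneq u v) => [-> | uv].
  rewrite degreeE (_ : incident _ v = set0) ?cards0 //; apply/setP => f.
  rewrite !inE; apply: contraTF isT => /andP[/andP[fFF' fE] vf].
  have : f \in incident (edges G) v by rewrite inE fE.
  rewrite incident_star => /imsetP[x /setIP[_ vx] fE'].
  have : x \in A :|: B by rewrite AB !inE eq_sym adj_neq //; rewrite inE in vx.
  move: fFF'; rewrite negb_or => /andP[fF fF'].
  case/setUP => xC.
    have : f \in star A by apply/imsetP; exists x; rewrite // in_setI xC.
    by rewrite starA inE (negPf fF).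
  have : f \in star B by apply/imsetP; exists x; rewrite // in_setI xC.
  by rewrite starB inE (negPf fF').
apply/implyP => _; move: uv; rewrite -nv => /orP[uA | uB].
  by have [] := half_coloring_local hF hF' uA; rewrite // in_setU1 negb_or -nv uA (disjointFr dAB uA).
rewrite (setUC F F').
by have [] := half_coloring_local hF' hF uB; rewrite // in_setU1 negb_or -nv uB orbT (disjointFl dAB uB).
Qed.

End Assembly.

Theorem theorem1p7 (G : sgraph)
    (G_3connected : kconnected 3 G)
    (G_odd_order : odd #|G|)
    (G_two_even : 1 < #|[set v : G | ~~ odd (degree (edges G) v)]|) :
  odd_chromatic_index G <= 3.
Proof.
set T := [set v : G | _] in G_two_even.
have Todd : odd #|T| by rewrite odd_card_even_degree.
have [v vT] : exists v, v \in T by apply/card_gt0P; exact: ltnW.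
have [ltG Gconn] := G_3connected.
pose U := ~: [set v].
have Uconn : conn (@adj G) U by apply/connected_on_conn/Gconn; rewrite cards1.
(* Deleting [v] and [x] removes at most two vertices, so 3-connectivity applies. *)
have Uconn1 : {in U, forall x, conn (@adj G) (U :\ x)}.
  move=> x _; rewrite /U setDE -setCU; apply/connected_on_conn/Gconn.
  by rewrite (leq_ltn_trans (leq_card_setU _ _)) // !cards1.
have Wodd : ~~ odd #|T :\ v| by move: Todd; rewrite (cardsD1 v) vT.
have NU : nbrs v \subset U.
  by apply/subsetP => x; rewrite !inE => vx; rewrite eq_sym adj_neq.
have Nodd : ~~ odd #|nbrs v|.
  by move: vT; rewrite inE degreeE incident_star card_star setTI.
(* The second vertex of even degree enters here. *)
have W0 : T :\ v != set0.
  by rewrite -card_gt0; move: G_two_even; rewrite (cardsD1 v) vT.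
have WU : T :\ v \subset U by rewrite /U setDE subsetIr.
have N0 : nbrs v != set0.
  have setTconn : conn (@adj G) setT.
    by rewrite -setC0; apply/connected_on_conn/Gconn; rewrite cards0.
  have [x xW] := set0Pn _ W0; have xv : x != v by move: xW; rewrite in_setD1 => /andP[].
  have [|a [b [/set1P -> _ vb]]] :=
    neighbor_outside setTconn (subsetT [set v]) (set11 v) (in_setT x); first by rewrite inE.
  by apply/set0Pn; exists b; rewrite inE.
have [A [/and3P[AU Aconn Bconn] AW AN]] :=
  odd_odd_bond (@adj_sym G) Uconn Uconn1 WU NU W0 N0.
(* An even subset of [U] that meets [A] in an odd number of vertices also meets the other side in an
   odd number. *)
have oddB (S : {set G}) : S \subset U -> ~~ odd #|S| -> odd #|A :&: S| -> odd #|(U :\: A) :&: S|.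
  move=> SU oS oA; have -> : (U :\: A) :&: S = S :\: A.
    by rewrite setIDAC (setIidPr SU).
  by move: oS; rewrite -(cardsID A S) (setIC S A) oddD oA /= negbK.
have vU : v \notin U by rewrite !inE eqxx.
have evens (C : {set G}) : C \subset U -> [set u in C | ~~ odd (degree (edges G) u)] = C :&: (T :\ v).
  move=> CU; apply/setP => u; rewrite !inE; case: (boolP (u \in C)) => //= uC.
  by have := subsetP CU u uC; rewrite !inE => ->.
(* The opposite choices [true] and [false] on the two sides make both colors odd at [v] in the
   union. *)
have [|||F [c [hF oF]]] := @half_coloring_exists G v A true Aconn; rewrite ?evens //.
  by apply: contra vU; exact: (subsetP AU).
have [|||F' [c' [hF' oF']]] := @half_coloring_exists G v (U :\: A) false Bconn.
- by rewrite inE (negPf vU) andbF.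
- exact: oddB.
- by rewrite evens ?subsetDl ?oddB.
apply: (glue_half_colorings _ _ hF hF' oF oF'); last by rewrite disjoint_sym disjoints_subset setDE subsetIr.
by apply/setP => u; rewrite !inE; case: (boolP (u \in A)) => //= /(subsetP AU); rewrite !inE.
Qed.
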